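(* Let $\lambda_a>0$ and $\lambda_x\ge 0$. Consider the system $$\dot a=\frac{aH^3(1-4\delta)}{H^3/a+3\lambda_a(1-6\delta+12\delta^2)a^2+3\lambda_xH^2/a^2+18\lambda_a\lambda_x},$$ $$\dot\delta=\frac{-H^4/a-6\lambda_a aH^2}{H^3/a+3\lambda_a(1-6\delta+12\delta^2)a^2+3\lambda_xH^2/a^2+18\lambda_a\lambda_x},$$ where $H=a\delta(1-2\delta)$, with initial data $a(0)=8$ and $\delta(0)=\frac14$. Then the solution exists for all $t\ge0$ and the parameters $a(t)$, $\delta(t)$ and $H(t)$ remain bounded for all time; in particular no finite-time blowup occurs.
   Context: The system is the SPIKE parameter evolution for Burgers' equation $\partial_tu+\partial_x(u^2/2)=0$ on $\mathbb{T}=\mathbb{R}/\mathbb{Z}$ with the two-kernel ansatz $u(x;\theta(t))=a(t)\varphi(x+\delta(t))-a(t)\varphi(x-\delta(t))$, $\varphi(x)=\frac12\{x\}^2-\frac12\{x\}+\frac1{12}$ ($\{x\}$ the fractional part), where $(\dot a,\dot\delta)$ minimizes $\int_{\mathbb{T}}(\partial_tu+\partial_x(u^2/2))^2dx+2\lambda_a\dot a^2+2\lambda_x\dot\delta^2$. *)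

(* Defs.v *)
From Stdlib Require Import Reals.
Open Scope R_scope.

Definition H_of (a delta : R) : R := a * delta * (1 - 2 * delta).

Definition denom (lambda_a lambda_x a delta : R) : R :=
  H_of a delta ^ 3 / a
  + 3 * lambda_a * (1 - 6 * delta + 12 * delta ^ 2) * a ^ 2
  + 3 * lambda_x * H_of a delta ^ 2 / a ^ 2
  + 18 * lambda_a * lambda_x.

Definition a_rhs (lambda_a lambda_x a delta : R) : R :=
  a * H_of a delta ^ 3 * (1 - 4 * delta) / denom lambda_a lambda_x a delta.

Definition delta_rhs (lambda_a lambda_x a delta : R) : R :=
  (- (H_of a delta ^ 4 / a) - 6 * lambda_a * a * H_of a delta ^ 2)
  / denom lambda_a lambda_x a delta.

(* [D_in f f' J t] is the derivative relative to [J], hence the right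
   derivative at the left endpoint 0.  Division is total, so the conditions
   [a t <> 0] and [denom _ _ _ _ <> 0] keep the trajectory inside the domain
   of the vector field. *)
Definition is_solution_on (lambda_a lambda_x : R) (J : R -> Prop)
    (a delta : R -> R) : Prop :=
  a 0 = 8 /\ delta 0 = 1 / 4 /\
  forall t : R, J t ->
    a t <> 0 /\ denom lambda_a lambda_x (a t) (delta t) <> 0 /\
    D_in a (fun s => a_rhs lambda_a lambda_x (a s) (delta s)) J t /\
    D_in delta (fun s => delta_rhs lambda_a lambda_x (a s) (delta s)) J t.

(* Main.v *)
(* The quantity H^2 + 6 lambda_a a^2 is conserved, so a is a positive function of
   delta and the system reduces to one autonomous equation delta' = G(delta) on
   (0, 1/2) with -K x^2 <= G(x) < 0.  The travel time F(x), the integral of 1/G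
   from 1/4 to x, grows at least like 1/(K x) as x -> 0, so delta takes infinite
   time to reach the equilibrium 0; delta is the inverse of F. *)

Require Import Defs.
From Stdlib Require Import Reals Ranalysis5 Lra Classical ClassicalEpsilon.
From Coquelicot Require Import Coquelicot.
Open Scope R_scope.

(** * Calculus on a half-line and induction along an interval *)

Lemma is_derive_continuity_pt (f : R -> R) (x l : R) :
  is_derive f x l -> continuity_pt f x.
Proof.
intro H. apply is_derive_Reals in H.
apply derivable_continuous_pt. exists l. exact H.
Qed.

(** Freezing [f] at its value at 0 for negative times turns a trajectory into a function on all of
    [R], to which two-sided calculus applies. At an interior time, all nearby points lie in [J], so
    the relative derivative is the ordinary one. *)
Lemma D_in_halfline_derive (f g : R -> R) (J : R -> Prop) (T t : R) :
  (forall s, 0 <= s < T -> J s) -> 0 < t < T -> D_in f g J t ->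
  is_derive (fun s => f (Rmax 0 s)) t (g t).
Proof.
intros HJ Ht Hd. apply is_derive_Reals. intros eps Heps.
destruct (Hd eps Heps) as [d [Hd0 Hd1]].
assert (Hm : 0 < Rmin d (Rmin t (T - t))) by (repeat apply Rmin_pos; lra).
exists (mkposreal _ Hm). intros k Hk Hkd. simpl in Hkd.
pose proof (Rmin_l d (Rmin t (T - t))). pose proof (Rmin_r d (Rmin t (T - t))).
pose proof (Rmin_l t (T - t)). pose proof (Rmin_r t (T - t)).
assert (Hk2 := Rabs_def2 _ _ Hkd).
rewrite !Rmax_right by lra.
specialize (Hd1 (t + k)). simpl in Hd1. unfold Rdist in Hd1.
replace (t + k - t) with k in Hd1 by ring.
apply Hd1. split; [split; [apply HJ | ] | ]; lra.
Qed.

Lemma D_in_halfline_continuous (f g : R -> R) (J : R -> Prop) (T t : R) :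
  (forall s, 0 <= s < T -> J s) -> 0 <= t < T -> D_in f g J t ->
  continuity_pt (fun s => f (Rmax 0 s)) t.
Proof.
intros HJ Ht Hd. apply cont_deriv in Hd. intros eps Heps.
destruct (Hd eps Heps) as [d [Hd0 Hd1]].
exists (Rmin d (T - t)). split; [apply Rmin_pos; lra | ].
intros x [_ Hx]. simpl in *. unfold Rdist in *.
pose proof (Rmin_l d (T - t)). pose proof (Rmin_r d (T - t)).
apply Rabs_def2 in Hx. rewrite (Rmax_right 0 t) by lra.
destruct (Rle_dec 0 x).
- rewrite Rmax_right by lra.
  destruct (Req_dec x t) as [-> | Hne].
  + rewrite Rminus_diag, Rabs_R0. lra.
  + apply Hd1. split; [split; [apply HJ | ] | apply Rabs_def1]; lra.
- rewrite Rmax_left by lra.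
  destruct (Req_dec t 0) as [-> | Hne].
  + rewrite Rminus_diag, Rabs_R0. lra.
  + apply Hd1. split; [split; [apply HJ | ] | apply Rabs_def1]; lra.
Qed.

Lemma null_derivative_constant (f : R -> R) (s t : R) :
  s <= t ->
  (forall u, s <= u <= t -> continuity_pt f u) ->
  (forall u, s < u < t -> is_derive f u 0) ->
  f t = f s.
Proof.
intros Hst Hc Hd.
destruct (MVT_gen f s t (fun _ => 0)) as [c [_ Hc2]].
- rewrite Rmin_left, Rmax_right by lra. exact Hd.
- rewrite Rmin_left, Rmax_right by lra. exact Hc.
- lra.
Qed.

(** Take the supremum of the [r] such that [P] holds on [[0, r]]: the closedness hypothesis gives
    [P] there, and the openness hypothesis would push past it if it were below [t]. *)
Lemma nonneg_interval_induction (P : R -> Prop) (t : R) :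
  0 <= t -> P 0 ->
  (forall s, 0 < s <= t -> (forall u, 0 <= u < s -> P u) -> P s) ->
  (forall s, 0 <= s < t -> P s ->
     exists e, 0 < e /\ forall u, s <= u <= s + e -> u <= t -> P u) ->
  P t.
Proof.
intros Ht H0 Hclosed Hopen.
set (S := fun r => 0 <= r <= t /\ forall u, 0 <= u <= r -> P u).
assert (S0 : S 0).
{ split; [lra | ]. intros u Hu. replace u with 0 by lra. exact H0. }
destruct (completeness S) as [s [Hub Hlub]].
- exists t. intros r [Hr _]. lra.
- exists 0. exact S0.
- assert (Hs0 : 0 <= s) by (apply Hub, S0).
  assert (Hst : s <= t) by (apply Hlub; intros r [Hr _]; lra).
  assert (Hbelow : forall u, 0 <= u < s -> P u).
  { intros u Hu. apply NNPP. intro Hn.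
    assert (s <= u); [ | lra]. apply Hlub. intros r [Hr HP].
    destruct (Rle_dec r u); [assumption | ]. exfalso. apply Hn, HP. lra. }
  assert (HPs : P s).
  { destruct (Req_dec s 0) as [-> | ]; [exact H0 | ].
    apply Hclosed; [lra | exact Hbelow]. }
  destruct (Req_dec s t) as [<- | Hne]; [exact HPs | ].
  destruct (Hopen s) as [e [He HPe]]; [lra | exact HPs | ].
  pose proof (Rmin_l (s + e) t). pose proof (Rmin_r (s + e) t).
  assert (s < Rmin (s + e) t) by (apply Rmin_glb_lt; lra).
  assert (S (Rmin (s + e) t)).
  { split; [lra | ]. intros u Hu. destruct (Rlt_dec u s).
    - apply Hbelow. lra.
    - apply HPe; lra. }
  assert (Rmin (s + e) t <= s) by (apply Hub; assumption). lra.
Qed.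

(** * Travel time of a scalar autonomous equation and its inverse *)

Lemma travel_time_exists (G : R -> R) (r x0 : R) :
  0 < x0 < r ->
  (forall x, 0 < x < r -> continuous G x /\ G x < 0) ->
  exists F : R -> R, F x0 = 0 /\
    forall x, 0 < x < r -> is_derive F x (/ G x).
Proof.
intros Hx0 HG. exists (RInt (fun y => / G y) x0). split.
- rewrite RInt_point. reflexivity.
- intros x Hx.
  assert (Hcont : forall y, 0 < y < r -> continuous (fun y => / G y) y).
  { intros y Hy. destruct (HG y Hy). apply continuous_comp with (g := Rinv).
    - assumption.
    - apply continuous_Rinv. lra. }
  apply (is_derive_RInt (fun y => / G y) _ x0).
  + assert (Hm : 0 < Rmin x (r - x)) by (apply Rmin_pos; lra).
    exists (mkposreal _ Hm). intros y Hy.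
    change (Rabs (y - x) < Rmin x (r - x)) in Hy.
    pose proof (Rmin_l x (r - x)). pose proof (Rmin_r x (r - x)).
    apply Rabs_def2 in Hy.
    apply (RInt_correct (V := R_CompleteNormedModule)), (ex_RInt_continuous (V := R_CompleteNormedModule)).
    intros z Hz. apply Hcont.
    revert Hz. apply Rmin_case; apply Rmax_case; intros; lra.
  + apply Hcont, Hx.
Qed.

(** Comparison with the equation [x' = - K x^2]: since [/ G x + / (K * x ^ 2) <= 0], the function
    [F x - / (K * x)] is nonincreasing, so [F] is unbounded near 0 and the intermediate value
    theorem applies. *)
Lemma travel_time_onto (G F : R -> R) (r x0 K t : R) :
  0 < x0 < r -> 0 < K ->
  (forall x, 0 < x < r -> - (K * x ^ 2) <= G x < 0) ->
  F x0 = 0 ->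
  (forall x, 0 < x < r -> is_derive F x (/ G x)) ->
  0 <= t -> exists x, 0 < x <= x0 /\ F x = t.
Proof.
intros Hx0 HK HG HF0 HF Ht.
destruct (Req_dec t 0) as [-> | Hne]; [exists x0; lra | ].
(* Chosen so that [/ (K * x1) - / (K * x0) = t + 1]; the extra 1 gives the strict sign
   [t - F x1 < 0] for the intermediate value theorem. *)
set (x1 := / (K * (t + 1) + / x0)).
assert (Hi0 : 0 < / x0) by (apply Rinv_0_lt_compat; lra).
assert (Hi1 : / x0 < K * (t + 1) + / x0) by nra.
assert (Hx1 : 0 < x1) by (apply Rinv_0_lt_compat; lra).
assert (Hx10 : x1 < x0).
{ rewrite <- (Rinv_inv x0). apply Rinv_lt_contravar; [ | exact Hi1].
  apply Rmult_lt_0_compat; lra. }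
assert (HFx1 : t + 1 <= F x1).
{ destruct (MVT_gen (fun x => F x - / (K * x)) x1 x0
             (fun x => / G x + / (K * x ^ 2))) as [c [Hc Hmvt]].
  - rewrite Rmin_left, Rmax_right by lra. intros x Hx.
    assert (Hdx := HF x ltac:(lra)).
    replace (/ G x + / (K * x ^ 2)) with (minus (/ G x) (- K / (K * x) ^ 2)).
    + apply (is_derive_minus F). exact Hdx.
      auto_derive; [nra | ]. field. lra.
    + unfold minus, plus, opp; simpl. field.
      destruct (HG x ltac:(lra)). split; lra.
  - rewrite Rmin_left, Rmax_right by lra. intros x Hx.
    assert (Hdx := HF x ltac:(lra)).
    apply continuity_pt_minus.
    + exact (is_derive_continuity_pt _ _ _ Hdx).
    + apply (is_derive_continuity_pt _ _ (- K / (K * x) ^ 2)).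
      auto_derive; [nra | ]. field. lra.
  - rewrite Rmin_left, Rmax_right in Hc by lra.
    assert (Hneg : / G c + / (K * c ^ 2) <= 0).
    { destruct (HG c ltac:(lra)) as [Hg1 Hg2].
      assert (/ (K * c ^ 2) <= / - G c) by (apply Rinv_le_contravar; lra).
      rewrite Rinv_opp in H. lra. }
    assert (/ (K * x1) = t + 1 + / (K * x0)).
    { rewrite Rinv_mult. unfold x1. rewrite Rinv_inv. field. lra. }
    nra. }
destruct (IVT_interv (fun x => t - F x) x1 x0) as [z [Hz Hz0]].
- intros x Hx. apply continuity_pt_minus.
  + apply continuity_pt_const. intros ? ?; reflexivity.
  + apply (is_derive_continuity_pt _ _ (/ G x)), HF. lra.
- exact Hx10.
- lra.
- lra.
- exists z. split; lra.
Qed.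

(** The mean value theorem for [F], solved for the increment of position. It yields both the
    injectivity of [F] and the difference quotients of its inverse. *)
Lemma travel_time_increment (G F : R -> R) (r x y : R) :
  (forall x, 0 < x < r -> G x < 0) ->
  (forall x, 0 < x < r -> is_derive F x (/ G x)) ->
  0 < x < r -> 0 < y < r ->
  exists z, Rmin x y <= z <= Rmax x y /\ y - x = G z * (F y - F x).
Proof.
intros HG HF Hx Hy.
assert (Hbt : forall z, Rmin x y <= z <= Rmax x y -> 0 < z < r).
{ intro z. apply Rmin_case; apply Rmax_case; intros; lra. }
destruct (MVT_gen F x y (fun x => / G x)) as [c [Hc Hmvt]].
- intros z Hz. apply HF, Hbt. lra.
- intros z Hz. apply (is_derive_continuity_pt _ _ (/ G z)), HF, Hbt, Hz.
- exists c. split; [exact Hc | ]. rewrite Hmvt.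
  specialize (HG c (Hbt c Hc)). field. lra.
Qed.

(** The solution is the inverse of the travel time. For uniqueness, [eta] is tied to [G] only while
    it lies in [(0, r)]; that it never leaves this interval is part of what the induction proves. *)
Lemma scalar_ode_global (G : R -> R) (r x0 K : R) :
  0 < x0 < r -> 0 < K ->
  (forall x, 0 < x < r -> continuous G x /\ - (K * x ^ 2) <= G x < 0) ->
  exists delta : R -> R,
    delta 0 = x0 /\
    (forall t, 0 <= t -> 0 < delta t <= x0) /\
    (forall t, 0 <= t ->
       D_in delta (fun s => G (delta s)) (fun s => 0 <= s) t) /\
    (forall (T : R) (eta : R -> R), eta 0 = x0 ->
       (forall t, 0 <= t < T -> exists d,
          D_in eta (fun _ => d) (fun s => 0 <= s < T) t /\
          (0 < eta t < r -> d = G (eta t))) ->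
       forall t, 0 <= t < T -> eta t = delta t).
Proof.
intros Hx0 HK HG.
assert (HGneg : forall x, 0 < x < r -> G x < 0) by (intros x Hx; apply HG, Hx).
destruct (travel_time_exists G r x0 Hx0) as [F [HF0 HF]].
{ intros x Hx. split; apply HG, Hx. }
(* The condition [0 <= t] sits under the existential so that choice gives a total function; the
   witness 0 at negative times is a dummy. *)
assert (Hex : forall t, exists x, 0 <= t -> 0 < x <= x0 /\ F x = t).
{ intro t. destruct (Rle_dec 0 t) as [Ht | Ht].
  - destruct (travel_time_onto G F r x0 K t) as [x Hx]; auto.
    { intros x Hx. apply HG, Hx. }
    exists x. intros _. exact Hx.
  - exists 0. intro. lra. }
set (delta := fun t => proj1_sig (constructive_indefinite_description _ (Hex t))).
assert (Hdelta := fun t =>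
  proj2_sig (constructive_indefinite_description _ (Hex t))).
change (forall t, 0 <= t -> 0 < delta t <= x0 /\ F (delta t) = t) in Hdelta.
clearbody delta.
assert (Hincr := fun x y => travel_time_increment G F r x y HGneg HF).
assert (Hinj : forall x y, 0 < x < r -> 0 < y < r -> F x = F y -> x = y).
{ intros x y Hx Hy Hxy. destruct (Hincr x y Hx Hy) as [z [_ Hz]].
  rewrite Hxy in Hz. lra. }
assert (Hder : forall t, 0 <= t ->
  D_in delta (fun s => G (delta s)) (fun s => 0 <= s) t).
{ intros t Ht. destruct (Hdelta t Ht) as [Hdt HFt].
  destruct (HG (delta t) ltac:(lra)) as [HGc _].
  apply continuity_pt_filterlim in HGc.
  intros eps Heps.
  destruct (HGc eps Heps) as [d [Hd Hcont]].
  assert (exists M, 0 < M /\ forall z, 0 < z <= x0 -> - G z <= M)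
    as [M [HM HGM]].
  (* A bound for the speed on [(0, x0]], which makes [delta] Lipschitz with constant [M]; hence the
     radius [d / M] below. *)
  { exists (K * x0 ^ 2). split.
    - apply Rmult_lt_0_compat; [lra | apply pow_lt; lra].
    - intros z Hz. destruct (HG z ltac:(lra)) as [_ Hgz].
      assert (z ^ 2 <= x0 ^ 2) by (apply pow_incr; lra). nra. }
  exists (d / M). split; [apply Rdiv_lt_0_compat; lra | ].
  intros s [[Hs Hts] Hst]. simpl in *. unfold Rdist in *.
  destruct (Hdelta s Hs) as [Hds HFs].
  destruct (Hincr (delta t) (delta s)) as [z [Hz Hinc]]; [lra | lra | ].
  rewrite HFs, HFt in Hinc.
  assert (Hzr : 0 < z <= x0).
  { revert Hz. apply Rmin_case; apply Rmax_case; intros; lra. }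
  destruct (HG z ltac:(lra)) as [_ Hgz].
  assert (Habs : Rabs (delta s - delta t) < d).
  { rewrite Hinc, Rabs_mult. rewrite (Rabs_left (G z)) by lra.
    apply Rlt_div_r in Hst; [ | lra].
    specialize (HGM z Hzr).
    pose proof (Rabs_pos (s - t)). nra. }
  replace ((delta s - delta t) / (s - t)) with (G z)
    by (rewrite Hinc; field; lra).
  (* Continuity of [G] is stated with a punctured neighbourhood, so the point itself is treated
     apart. *)
  destruct (Req_dec z (delta t)) as [-> | Hzd].
  - rewrite Rminus_diag, Rabs_R0. lra.
  - apply Hcont. repeat split; auto.
    apply Rabs_def2 in Habs. apply Rabs_def1;
    revert Hz; apply Rmin_case; apply Rmax_case; intros; lra. }
exists delta. split; [ | split; [ | split; [exact Hder | ]]].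
- destruct (Hdelta 0 ltac:(lra)) as [Hd0 HFd]. apply Hinj; lra.
- intros t Ht. apply Hdelta, Ht.
- intros T eta Heta0 Heta t Ht.
  set (e := fun s => eta (Rmax 0 s)).
  assert (He : forall s, 0 <= s -> e s = eta s)
    by (intros s Hs; unfold e; rewrite Rmax_right by lra; reflexivity).
  assert (Hec : forall s, 0 <= s < T -> continuity_pt e s).
  { intros s Hs. destruct (Heta s Hs) as [d [Hd _]].
    apply (D_in_halfline_continuous eta _ _ T s (fun u Hu => Hu) Hs Hd). }
  set (P := fun s => 0 < e s < r /\ F (e s) = s).
  assert (HP : P t).
  { apply nonneg_interval_induction.
    - lra.
    - unfold P. rewrite He, Heta0 by lra. split; [lra | exact HF0].
    - intros s Hs Hbelow.
      (* Below [s] the travel time is the clock, so [eta] agrees there with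
         [delta], which stays away from 0 and [r]. *)
      assert (Heq : e s = delta s).
      { set (dt := fun u => delta (Rmax 0 u)).
        assert (Hdc : continuity_pt dt s).
        { apply (D_in_halfline_continuous delta (fun u => G (delta u))
            (fun u => 0 <= u) T s); [intros; lra | lra | apply Hder; lra]. }
        assert (Hphi : continuity_pt (fun u => e u - dt u) s).
        { apply continuity_pt_minus; [apply Hec; lra | exact Hdc]. }
        apply NNPP. intro Hn.
        assert (Hdts : dt s = delta s)
          by (unfold dt; rewrite Rmax_right by lra; reflexivity).
        destruct (Hphi (Rabs (e s - dt s))) as [al [Hal Hnear]].
        { apply Rabs_pos_lt. lra. }
        assert (Hm : 0 < Rmin al s) by (apply Rmin_pos; lra).
        pose proof (Rmin_l al s). pose proof (Rmin_r al s).
        set (u := s - Rmin al s / 2).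
        assert (Hu : 0 <= u < s) by (unfold u; lra).
        destruct (Hbelow u Hu) as [Hur HFu].
        assert (Hedu : e u = dt u).
        { unfold dt. rewrite Rmax_right by lra.
          destruct (Hdelta u ltac:(lra)). apply Hinj; lra. }
        specialize (Hnear u). simpl in Hnear. unfold Rdist in Hnear.
        rewrite Hedu, Rminus_diag, Rminus_0_l, Rabs_Ropp in Hnear.
        apply (Rlt_irrefl (Rabs (e s - dt s))), Hnear.
        split; [split; [exact I | lra] | ].
        unfold u. apply Rabs_def1; lra. }
      destruct (Hdelta s ltac:(lra)) as [Hds HFs].
      unfold P. rewrite Heq. split; lra.
    (* Continuity keeps [e] inside [(0, r)] for a short time after [s]; there [F (e v) - v] has
       derivative [G * / G - 1 = 0], so the travel time stays equal to the clock. *)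
    - intros s Hs [Hes HFes].
      assert (Hm : 0 < Rmin (e s) (r - e s)) by (apply Rmin_pos; lra).
      destruct (Hec s ltac:(lra) _ Hm) as [al [Hal Hnear]].
      exists (al / 2). split; [lra | ].
      assert (Hin : forall u, s <= u <= s + al / 2 -> 0 < e u < r).
      { intros u Hu. destruct (Req_dec s u) as [<- | Hne]; [exact Hes | ].
        specialize (Hnear u). simpl in Hnear. unfold Rdist in Hnear.
        pose proof (Rmin_l (e s) (r - e s)). pose proof (Rmin_r (e s) (r - e s)).
        assert (Rabs (e u - e s) < Rmin (e s) (r - e s)) as Hab.
        { apply Hnear. split; [split; [exact I | lra] | ].
          apply Rabs_def1; lra. }
        apply Rabs_def2 in Hab. lra. }
      intros u Hu Hut. split; [apply Hin, Hu | ].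
      assert (F (e u) - u = F (e s) - s); [ | lra].
      apply (null_derivative_constant (fun v => F (e v) - v)); [lra | | ].
      + intros v Hv. apply continuity_pt_minus.
        * apply (continuity_pt_comp e F); [apply Hec; lra | ].
          apply (is_derive_continuity_pt _ _ (/ G (e v))), HF, Hin. lra.
        * apply continuity_pt_id.
      + intros v Hv. assert (Hev := Hin v ltac:(lra)).
        destruct (Heta v ltac:(lra)) as [d [Hd HdG]].
        rewrite <- He in HdG by lra. specialize (HdG Hev). subst d.
        replace 0 with (minus (scal (G (e v)) (/ G (e v))) 1).
        * apply (is_derive_minus (fun v => F (e v)) (fun v => v)).
          -- apply (is_derive_comp F e); [apply HF, Hev | ].
             apply (D_in_halfline_derive eta (fun _ => G (e v)) _ T v
                      (fun u Hu => Hu)); [lra | exact Hd].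
          -- apply (is_derive_id (K := R_AbsRing)).
        * unfold minus, plus, opp, scal; simpl. unfold mult; simpl.
          field. specialize (HGneg _ Hev). lra. }
  destruct HP as [Htr HFt]. rewrite He in Htr, HFt by lra.
  destruct (Hdelta t ltac:(lra)). apply Hinj; lra.
Qed.

(** * Elimination of [a] by the conserved quantity *)

Definition profile (x : R) : R := x * (1 - 2 * x).

(* The solution for [a] of [H^2 + 6 lambda_a a^2 = 1 + 384 lambda_a], the value
   of the conserved quantity at [a = 8], [delta = 1/4]. *)
Definition amplitude (la x : R) : R :=
  sqrt ((1 + 384 * la) / (profile x ^ 2 + 6 * la)).

(** The field [G] of the reduced equation. The factor [profile] is [H / a]. *)
Definition speed (la lx x : R) : R := delta_rhs la lx (amplitude la x) x.

Lemma profile_bounds (x : R) : 0 < x < 1 / 2 -> 0 < profile x <= x /\ profile x <= 1 / 8.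
Proof.
unfold profile. intro Hx.
pose proof (Rmult_lt_0_compat x (1 - 2 * x) ltac:(lra) ltac:(lra)).
pose proof (pow2_ge_0 (4 * x - 1)). nra.
Qed.

Lemma weight_pos (la x : R) : 0 < la -> 0 < profile x ^ 2 + 6 * la.
Proof. intro. pose proof (pow2_ge_0 (profile x)). lra. Qed.

Lemma amplitude_pos (la x : R) : 0 < la -> 0 < amplitude la x.
Proof.
intro Hla. apply sqrt_lt_R0, Rdiv_lt_0_compat; [lra | apply weight_pos, Hla].
Qed.

Lemma amplitude_conservation (la x : R) :
  0 < la -> amplitude la x ^ 2 * (profile x ^ 2 + 6 * la) = 1 + 384 * la.
Proof.
intro Hla. assert (Hw := weight_pos la x Hla).
unfold amplitude. rewrite pow2_sqrt.
- field. lra.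
- apply Rlt_le, Rdiv_lt_0_compat; lra.
Qed.

Lemma amplitude_unique (la a x : R) :
  0 < la -> 0 < a -> a ^ 2 * (profile x ^ 2 + 6 * la) = 1 + 384 * la ->
  a = amplitude la x.
Proof.
intros Hla Ha HE. assert (Hw := weight_pos la x Hla).
unfold amplitude. rewrite <- HE.
replace (a ^ 2 * (profile x ^ 2 + 6 * la) / (profile x ^ 2 + 6 * la))
  with (a ^ 2) by (field; lra).
rewrite sqrt_pow2; lra.
Qed.

(** The maximum 1/8 of [profile] is attained at the initial position 1/4, so the initial amplitude 8
    is the smallest one. *)
Lemma amplitude_ge_8 (la x : R) : 0 < la -> 0 < x < 1 / 2 -> 8 <= amplitude la x.
Proof.
intros Hla Hx. destruct (profile_bounds x Hx).
assert (HE := amplitude_conservation la x Hla).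
assert (HA := amplitude_pos la x Hla).
assert (profile x ^ 2 <= (1 / 8) ^ 2) by (apply pow_incr; lra).
destruct (Rle_dec 8 (amplitude la x)); [assumption | exfalso].
assert (amplitude la x ^ 2 < 64) by nra.
assert (0 < amplitude la x ^ 2) by nra.
nra.
Qed.

Lemma amplitude_le (la x : R) :
  0 < la -> amplitude la x <= sqrt ((1 + 384 * la) / (6 * la)).
Proof.
intro Hla. apply sqrt_le_1_alt, Rmult_le_compat_l; [lra | ].
apply Rinv_le_contravar; [lra | ]. pose proof (pow2_ge_0 (profile x)). lra.
Qed.

Lemma is_derive_profile (x : R) : is_derive profile x (1 - 4 * x).
Proof. unfold profile. auto_derive; [exact I | ring]. Qed.

(** The formula is implicit differentiation of the conservation law, with [profile' = 1 - 4 * x]. *)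
Lemma is_derive_amplitude (la x : R) :
  0 < la ->
  is_derive (amplitude la) x
    (- (amplitude la x * profile x * (1 - 4 * x) / (profile x ^ 2 + 6 * la))).
Proof.
intro Hla. assert (Hw := weight_pos la x Hla).
assert (HA := amplitude_pos la x Hla).
assert (HE := amplitude_conservation la x Hla).
assert (HC : 0 < (1 + 384 * la) / (profile x ^ 2 + 6 * la))
  by (apply Rdiv_lt_0_compat; lra).
assert (Hder := is_derive_profile x).
unfold amplitude at 1. auto_derive.
- split; [eexists; exact Hder | ]. split; [ | split; [ | exact I]]; simpl in *; lra.
- change (fun y : R => profile y) with profile.
  rewrite (is_derive_unique _ _ _ Hder).
  change (profile x * (profile x * 1)) with (profile x ^ 2).
  change (sqrt ((1 + 384 * la) * / (profile x ^ 2 + 6 * la)))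
    with (amplitude la x).
  rewrite <- HE. field. lra.
Qed.

(** * Estimates for the denominator and the reduced speed *)

Lemma denom_lower_bound (la lx a x : R) :
  0 <= la -> 0 <= lx -> a <> 0 -> 0 <= profile x ->
  3 / 4 * la * a ^ 2 <= denom la lx a x.
Proof.
intros Hla Hlx Ha Hx. unfold denom, H_of.
replace ((a * x * (1 - 2 * x)) ^ 3 / a) with (a ^ 2 * profile x ^ 3)
  by (unfold profile; field; exact Ha).
replace (3 * lx * (a * x * (1 - 2 * x)) ^ 2 / a ^ 2)
  with (3 * lx * profile x ^ 2) by (unfold profile; field; exact Ha).
assert (0 <= a ^ 2 * profile x ^ 3)
  by (apply Rmult_le_pos; [apply pow2_ge_0 | apply pow_le, Hx]).
assert (0 <= lx * profile x ^ 2)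
  by (apply Rmult_le_pos; [exact Hlx | apply pow2_ge_0]).
assert (0 <= la * lx) by (apply Rmult_le_pos; assumption).
(* Completing the square: [1 - 6 x + 12 x^2 = 1/4 + 3/4 (4 x - 1)^2]. *)
assert (0 <= la * (a * (4 * x - 1)) ^ 2)
  by (apply Rmult_le_pos; [exact Hla | apply pow2_ge_0]).
nra.
Qed.

Lemma denom_pos (la lx a x : R) :
  0 < la -> 0 <= lx -> a <> 0 -> 0 <= profile x -> 0 < denom la lx a x.
Proof.
intros Hla Hlx Ha Hx.
apply Rlt_le_trans with (3 / 4 * la * a ^ 2).
- apply Rmult_lt_0_compat; [lra | ]. apply pow2_gt_0, Ha.
- apply denom_lower_bound; lra.
Qed.

(** With [H = a * profile], the numerator is [- a^3 profile^2 (profile^2 + 6 la)], in which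
    [a^2 (profile^2 + 6 la)] is the conserved quantity. *)
Lemma speed_factored (la lx x : R) :
  0 < la -> 0 <= lx -> 0 <= profile x ->
  speed la lx x =
  - ((1 + 384 * la) * amplitude la x * profile x ^ 2
     / denom la lx (amplitude la x) x).
Proof.
intros Hla Hlx Hx. assert (HA := amplitude_pos la x Hla).
assert (HD := denom_pos la lx _ x Hla Hlx (Rgt_not_eq _ _ HA) Hx).
rewrite <- (amplitude_conservation la x Hla).
unfold speed, delta_rhs, H_of, profile. field. lra.
Qed.

Lemma speed_bounds (la lx x : R) :
  0 < la -> 0 <= lx -> 0 < x < 1 / 2 ->
  - ((1 + 384 * la) / (6 * la) * x ^ 2) <= speed la lx x < 0.
Proof.
intros Hla Hlx Hx. destruct (profile_bounds x Hx) as [[Hp Hpx] _].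
assert (HA := amplitude_ge_8 la x Hla Hx).
assert (HD := denom_lower_bound la lx (amplitude la x) x
  ltac:(lra) Hlx ltac:(lra) ltac:(lra)).
assert (HD0 := denom_pos la lx (amplitude la x) x
  Hla Hlx ltac:(lra) ltac:(lra)).
rewrite speed_factored by lra.
set (D := denom la lx (amplitude la x) x) in *.
set (A := amplitude la x) in *.
assert (Hp2 : 0 < profile x ^ 2) by (apply pow_lt, Hp).
assert (Hpx2 : profile x ^ 2 <= x ^ 2) by (apply pow_incr; lra).
split.
- apply Ropp_le_contravar. apply Rle_div_l; [exact HD0 | ].
  (* From [D >= 3/4 la A^2] and [A >= 8]; the factor [A] then cancels against the numerator. *)
  assert (HAD : 6 * la * A <= D) by nra.
  assert (H1 : (1 + 384 * la) / (6 * la) * x ^ 2 * (6 * la * A)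
    <= (1 + 384 * la) / (6 * la) * x ^ 2 * D).
  { apply Rmult_le_compat_l; [ | exact HAD].
    apply Rmult_le_pos; [ | apply pow2_ge_0].
    apply Rlt_le, Rdiv_lt_0_compat; lra. }
  replace ((1 + 384 * la) / (6 * la) * x ^ 2 * (6 * la * A))
    with ((1 + 384 * la) * A * x ^ 2) in H1 by (field; lra).
  assert ((1 + 384 * la) * A * profile x ^ 2 <= (1 + 384 * la) * A * x ^ 2).
  { apply Rmult_le_compat_l; [ | exact Hpx2].
    apply Rmult_le_pos; lra. }
  lra.
- apply Ropp_lt_gt_0_contravar, Rdiv_lt_0_compat; [ | exact HD0].
  apply Rmult_lt_0_compat; [apply Rmult_lt_0_compat; lra | exact Hp2].
Qed.

Lemma continuous_speed (la lx x : R) :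
  0 < la -> 0 <= lx -> 0 <= profile x -> continuous (speed la lx) x.
Proof.
intros Hla Hlx Hx. assert (HA := amplitude_pos la x Hla).
assert (HD := denom_pos la lx _ x Hla Hlx (Rgt_not_eq _ _ HA) Hx).
assert (Hder := is_derive_amplitude la x Hla).
apply (ex_derive_continuous (V := R_NormedModule)).
unfold speed, delta_rhs, denom, H_of. auto_derive.
unfold denom, H_of in HD.
repeat split; try (eexists; exact Hder); simpl in *; try lra.
nra.
Qed.

(** Chain rule: in the product of [speed] and the derivative of [amplitude], the weight
    [profile^2 + 6 la] cancels and [a_rhs] remains. *)
Lemma D_in_amplitude (la lx : R) (J : R -> Prop) (delta : R -> R) (t : R) :
  0 < la -> 0 <= lx -> 0 <= profile (delta t) ->
  D_in delta (fun s => speed la lx (delta s)) J t ->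
  D_in (fun s => amplitude la (delta s))
    (fun s => a_rhs la lx (amplitude la (delta s)) (delta s)) J t.
Proof.
intros Hla Hlx Hx Hd. assert (HA := amplitude_pos la (delta t) Hla).
assert (HD := denom_pos la lx _ _ Hla Hlx (Rgt_not_eq _ _ HA) Hx).
assert (Hw := weight_pos la (delta t) Hla).
assert (Hder := is_derive_amplitude la (delta t) Hla).
apply is_derive_Reals in Hder.
apply (derivable_pt_lim_D_in _ (fun x =>
  - (amplitude la x * profile x * (1 - 4 * x) / (profile x ^ 2 + 6 * la)))) in Hder.
assert (Hc := Dcomp _ _ _ _ _ _ _ Hd Hder). cbv beta in Hc.
intros eps Heps. destruct (Hc eps Heps) as [al [Hal Hnear]].
exists al. split; [exact Hal | ]. intros s [[Hs Hst] Hsd].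
replace (a_rhs la lx (amplitude la (delta t)) (delta t)) with
  (speed la lx (delta t) *
   - (amplitude la (delta t) * profile (delta t) * (1 - 4 * delta t)
      / (profile (delta t) ^ 2 + 6 * la))).
- apply Hnear. split; [ | exact Hsd]. split; [split; [exact Hs | exact I] | exact Hst].
- unfold speed, delta_rhs, a_rhs, H_of. unfold profile in *. field. lra.
Qed.

(** * Arbitrary solutions of the system: energy and sign *)

Lemma solution_energy (la lx T : R) (b eta : R -> R) (t : R) :
  is_solution_on la lx (fun s => 0 <= s < T) b eta -> 0 <= t < T ->
  b t ^ 2 * (profile (eta t) ^ 2 + 6 * la) = 1 + 384 * la.
Proof.
intros (Hb0 & He0 & Hsol) Ht.
set (B := fun s => b (Rmax 0 s)). set (N := fun s => eta (Rmax 0 s)).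
assert (HE : B t ^ 2 * (profile (N t) ^ 2 + 6 * la)
           = B 0 ^ 2 * (profile (N 0) ^ 2 + 6 * la)).
{ apply (null_derivative_constant
    (fun s => B s ^ 2 * (profile (N s) ^ 2 + 6 * la))); [lra | | ].
  - intros u Hu. destruct (Hsol u ltac:(lra)) as (_ & _ & Hdb & Hde).
    apply (D_in_halfline_continuous _ _ _ T) in Hdb; [ | auto | lra].
    apply (D_in_halfline_continuous _ _ _ T) in Hde; [ | auto | lra].
    assert (Hp : continuity_pt (fun s => profile (N s)) u).
    { apply (continuity_pt_comp N profile); [exact Hde | ].
      exact (is_derive_continuity_pt _ _ _ (is_derive_profile _)). }
    unfold pow. repeat first
      [ exact Hdb | exact Hp
      | apply continuity_pt_const; intros ? ?; reflexivity
      | apply continuity_pt_mult | apply continuity_pt_plus ].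
  - intros u Hu. destruct (Hsol u ltac:(lra)) as (Hbn & HDn & Hdb & Hde).
    apply (D_in_halfline_derive _ _ _ T) in Hdb; [ | auto | lra].
    apply (D_in_halfline_derive _ _ _ T) in Hde; [ | auto | lra].
    change (is_derive B u (a_rhs la lx (b u) (eta u))) in Hdb.
    change (is_derive N u (delta_rhs la lx (b u) (eta u))) in Hde.
    assert (HBu : B u = b u) by (unfold B; rewrite Rmax_right by lra; reflexivity).
    assert (HNu : N u = eta u) by (unfold N; rewrite Rmax_right by lra; reflexivity).
    unfold profile. auto_derive.
    + repeat split; eexists; eassumption.
    + change (fun y : R => B y) with B. change (fun y : R => N y) with N.
      rewrite (is_derive_unique _ _ _ Hdb), (is_derive_unique _ _ _ Hde).
      rewrite HBu, HNu. unfold a_rhs, delta_rhs, H_of. field.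
      split; assumption. }
unfold B, N in HE. rewrite !Rmax_right in HE by lra. rewrite HE, Hb0, He0.
unfold profile. field.
Qed.

(** A sign change from [b 0 = 8] would force a zero of [b], which [is_solution_on] excludes. This
    selects the positive root of the energy identity. *)
Lemma solution_amplitude_pos (la lx T : R) (b eta : R -> R) (t : R) :
  is_solution_on la lx (fun s => 0 <= s < T) b eta -> 0 <= t < T -> 0 < b t.
Proof.
intros (Hb0 & He0 & Hsol) Ht.
destruct (Req_dec t 0) as [-> | Hne]; [lra | ].
apply Rnot_le_lt. intro Hle.
destruct (Hsol t Ht) as [Hbt _].
destruct (IVT_interv (fun s => - b (Rmax 0 s)) 0 t) as [z [Hz Hz0]].
- intros u Hu. destruct (Hsol u ltac:(lra)) as (_ & _ & Hdb & _).
  apply continuity_pt_opp.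
  apply (D_in_halfline_continuous _ _ _ T) in Hdb; [exact Hdb | auto | lra].
- lra.
- rewrite Rmax_right by lra. lra.
- rewrite Rmax_right by lra. lra.
- rewrite Rmax_right in Hz0 by lra.
  destruct (Hsol z ltac:(lra)) as [Hbz _]. lra.
Qed.

Theorem mainTheorem4 (lambda_a lambda_x : R)
  (lambda_a_pos : 0 < lambda_a) (lambda_x_nonneg : 0 <= lambda_x) :
  exists a delta : R -> R,
    is_solution_on lambda_a lambda_x (fun t => 0 <= t) a delta /\
    (forall (T : R) (b eta : R -> R),
       is_solution_on lambda_a lambda_x (fun t => 0 <= t < T) b eta ->
       forall t : R, 0 <= t < T -> b t = a t /\ eta t = delta t) /\
    (exists M : R, forall t : R, 0 <= t ->
       Rabs (a t) <= M /\ Rabs (delta t) <= M /\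
       Rabs (H_of (a t) (delta t)) <= M).
Proof.
destruct (scalar_ode_global (speed lambda_a lambda_x) (1 / 2) (1 / 4)
  ((1 + 384 * lambda_a) / (6 * lambda_a)))
  as (delta & Hd0 & Hrange & Hder & Huniq).
{ lra. }
{ apply Rdiv_lt_0_compat; lra. }
{ intros x Hx. split.
  - apply continuous_speed; [assumption | assumption | ].
    destruct (profile_bounds x Hx). lra.
  - apply speed_bounds; assumption. }
assert (Hp : forall t, 0 <= t -> 0 < profile (delta t) <= 1 / 8).
{ intros t Ht. specialize (Hrange t Ht).
  destruct (profile_bounds (delta t)); lra. }
exists (fun t => amplitude lambda_a (delta t)), delta.
split; [ | split].
- split; [ | split; [exact Hd0 | ]].
  + symmetry. apply amplitude_unique; [assumption | lra | ].
    rewrite Hd0. unfold profile. field.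
  + intros t Ht. specialize (Hp t Ht).
    assert (HA := amplitude_pos lambda_a (delta t) lambda_a_pos).
    split; [lra | ]. split; [ | split].
    * apply Rgt_not_eq, denom_pos; lra.
    * apply D_in_amplitude; [assumption | assumption | lra | apply Hder, Ht].
    * apply Hder, Ht.
(* Energy and sign force [b = amplitude (eta)], so [eta] solves the reduced equation and scalar
   uniqueness applies. *)
- intros T b eta Hsol.
  assert (Hb : forall t, 0 <= t < T -> b t = amplitude lambda_a (eta t)).
  { intros t Ht. apply amplitude_unique; [assumption | | ].
    - exact (solution_amplitude_pos _ _ _ _ _ _ Hsol Ht).
    - exact (solution_energy _ _ _ _ _ _ Hsol Ht). }
  assert (Heta : forall t, 0 <= t < T -> eta t = delta t).
  { apply Huniq; [apply Hsol | ]. intros t Ht.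
    exists (delta_rhs lambda_a lambda_x (b t) (eta t)). split.
    - destruct Hsol as (_ & _ & Hsol). apply (Hsol t Ht).
    - intros _. unfold speed. rewrite Hb by exact Ht. reflexivity. }
  intros t Ht. rewrite Hb, Heta by exact Ht. split; reflexivity.
(* The root bounds [a], the added 1 covers [delta <= 1/4], and [H = a * profile <= a / 8]. *)
- exists (sqrt ((1 + 384 * lambda_a) / (6 * lambda_a)) + 1).
  intros t Ht. specialize (Hp t Ht). specialize (Hrange t Ht).
  assert (HA := amplitude_pos lambda_a (delta t) lambda_a_pos).
  assert (HAM := amplitude_le lambda_a (delta t) lambda_a_pos).
  unfold H_of. rewrite Rmult_assoc. fold (profile (delta t)).
  rewrite (Rabs_pos_eq (_ * _)) by (apply Rmult_le_pos; lra).
  rewrite !Rabs_pos_eq by lra.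
  repeat split; [lra | lra | nra].
Qed.
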